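(* Let $f\in L(X^o)$ and $g\in L(\partial X)$. The solutions $u\in L(X)$ of the Neumann problem $$\Delta u = f \text{ on } X^o \quad\text{and}\quad \partial_{\vec n}u = g \text{ on } \partial X$$ coincide with the solutions of the Poisson equation $\Delta u=\tilde f$ on $X$, where $\tilde f(x)=f(x)$ for $x\in X^o$ and $\tilde f(y)=-g(y)$ for $y\in\partial X$. In particular, the Neumann problem is solvable if and only if $$\int_{X^o} f \,d\pi = \int_{\partial X} g \,d\pi .$$
   Context: Let $(X,E)$ be a finite directed graph with $|X|\ge 2$, $E\subset X^2$ without loops, which is strongly connected. Each edge $(x,y)\in E$ carries a weight $a(x,y)>0$, and $a(x,y)=0$ if $(x,y)\notin E$. Put $m(x)=\sum_y a(x,y)$, $p(x,y)=a(x,y)/m(x)$, $P=(p(x,y))_{x,y\in X}$. $L(B)$ is the space of functions $B\to\mathbb{C}$, $Pu(x)=\sum_y p(x,y)u(y)$, and $\Delta=P-I$. $\pi$ denotes the unique stationary probability distribution of $P$ ($\pi P=\pi$, $\pi>0$, total mass $1$), and $\int_A f\,d\pi=\sum_{x\in A}f(x)\pi(x)$. The boundary $\partial X$ is an arbitrary non-empty subset of $X$, and $X^o=X\setminus\partial X$. The outer normal derivative is $\partial_{\vec n}u(x)=-\Delta u(x)$ for $x\in\partial X$. *)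

(* Defs.v *)
From HB Require Import structures.
From mathcomp Require Import all_boot all_order all_algebra.
From mathcomp Require Import reals.
From mathcomp Require Import complex.

Set Implicit Arguments.
Unset Strict Implicit.
Unset Printing Implicit Defensive.

Import GRing.Theory.
Local Open Scope ring_scope.
Local Open Scope complex_scope.

(* The complex numbers are [R[i]], for [R : realType] the real numbers. *)

(* [L(B)], the space of functions [B -> C] for a subset [B] of [X]; [L(X)]
   itself is rendered as [X -> R[i]]. *)
Definition funs_on (R : realType) (X : finType) (B : {set X}) : Type :=
  {x : X | x \in B} -> R[i].

Definition loopless (X : finType) (E : rel X) : Prop := irreflexive E.

Definition strongly_connected (X : finType) (E : rel X) : Prop :=
  forall x y : X, connect E x y.

Definition edge_weights (R : realType) (X : finType) (E : rel X)
    (a : X -> X -> R) : Prop :=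
  (forall x y, E x y -> 0 < a x y) /\ (forall x y, ~~ E x y -> a x y = 0).

Section Network.
Variables (R : realType) (X : finType) (a : X -> X -> R).

Definition total_weight (x : X) : R := \sum_(y : X) a x y.

Definition trans_prob (x y : X) : R := a x y / total_weight x.

Definition trans_op (u : X -> R[i]) (x : X) : R[i] :=
  \sum_(y : X) (trans_prob x y)%:C * u y.

Definition laplacian (u : X -> R[i]) (x : X) : R[i] := trans_op u x - u x.

Definition stationary_distribution (pi : X -> R) : Prop :=
  [/\ forall y, \sum_(x : X) pi x * trans_prob x y = pi y,
      forall x, 0 < pi x
    & \sum_(x : X) pi x = 1].

Definition integral_on (pi : X -> R) (A : {set X}) (f : funs_on R A) : R[i] :=
  \sum_(x : {x : X | x \in A}) f x * (pi (val x))%:C.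

Variable bd : {set X}.

Definition interior : {set X} := ~: bd.

Lemma notin_bd_interior (x : X) : x \notin bd -> x \in interior.
Proof. by rewrite inE. Qed.

Definition normal_derivative (u : X -> R[i]) : funs_on R bd :=
  fun x => - laplacian u (val x).

Definition neumann_solution (f : funs_on R interior) (g : funs_on R bd)
    (u : X -> R[i]) : Prop :=
  (forall x : {x : X | x \in interior}, laplacian u (val x) = f x) /\
  (forall y : {y : X | y \in bd}, normal_derivative u y = g y).

Definition poisson_solution (h u : X -> R[i]) : Prop :=
  forall x : X, laplacian u x = h x.

Definition glue_data (f : funs_on R interior) (g : funs_on R bd)
    (x : X) : R[i] :=
  match boolP (x \in bd) with
  | AltTrue x_bd => - g (exist _ x x_bd)
  | AltFalse x_nbd => f (exist _ x (notin_bd_interior x_nbd))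
  end.

End Network.

(* Main.v *)
Require Import Defs.
From mathcomp Require Import all_boot all_order all_algebra.
From mathcomp Require Import reals.
From mathcomp Require Import complex.

Local Open Scope ring_scope.

Import Order.TTheory GRing.Theory Num.Theory.

(** The normal derivative is minus the Laplacian at the boundary, so the
    Neumann problem is the Poisson equation whose right-hand side [h] is [f]
    inside and [- g] on the boundary ([neumann_poisson]), and the integral of
    [h] against [pi] is the difference of the two integrals of the solvability
    criterion ([integral_glue_data]).

    It remains to see that the Poisson equation is solvable exactly when [h]
    has integral zero ([poisson_solvable]); this is the Fredholm alternative.
    By the maximum principle, real harmonic functions are constant on a
    strongly connected graph ([harmonic_constant]), so the Laplacian has a
    kernel of dimension at most 1 and an image of codimension at most 1.  By
    stationarity, the image lies in the hyperplane orthogonal to [pi]; hence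
    it is that hyperplane ([laplacian_mx_image]).  The Laplacian and [pi] have
    real entries, and matrix kernels and row spaces commute with extension of
    scalars, so the description of the image carries over from the real to the
    complex numbers. *)

Section Chain.
Set Implicit Arguments.
Unset Strict Implicit.
Variables (R : realType) (X : finType) (E : rel X) (a : X -> X -> R).
Hypotheses (card_X : (2 <= #|X|)%N) (E_connected : strongly_connected E)
  (a_weights : edge_weights E a).

Lemma weight_ge0 x y : 0 <= a x y.
Proof.
have [a_gt0 a_eq0] := a_weights.
by case: (boolP (E x y)) => [/a_gt0/ltW // | /a_eq0 ->].
Qed.

(** Strong connectedness and a second vertex provide an edge out of [x]. *)
Lemma total_weight_gt0 x : 0 < total_weight a x.
Proof.
have [y neq_yx] : exists y, y != x.
  have /card_gt1P[y [z [_ _ neq_yz]]] := card_X.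
  have [eq_yx|] := eqVneq y x; last by exists y.
  by exists z; rewrite -eq_yx eq_sym.
have [[|z p] /= path_xy last_y] := connectP (E_connected x y).
  by rewrite last_y eqxx in neq_yx.
have [Exz _] := andP path_xy; have [a_gt0 _] := a_weights.
rewrite /total_weight (bigD1 z) //=; apply: ltr_wpDr (a_gt0 _ _ Exz).
by apply: sumr_ge0 => t _; apply: weight_ge0.
Qed.

Lemma trans_prob_ge0 x y : 0 <= trans_prob a x y.
Proof. by rewrite divr_ge0 ?weight_ge0 // ltW ?total_weight_gt0. Qed.

Lemma trans_prob_gt0 x y : E x y -> 0 < trans_prob a x y.
Proof.
by have [a_gt0 _] := a_weights => Exy; rewrite divr_gt0 ?a_gt0 ?total_weight_gt0.
Qed.

Lemma sum_trans_prob x : \sum_y trans_prob a x y = 1.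
Proof. by rewrite -mulr_suml divff // gt_eqF ?total_weight_gt0. Qed.

(** Maximum principle: where [u] attains its maximum, the mean value property
    forces the same value at all successors, and every vertex is reachable
    from a maximum. *)
Lemma harmonic_constant (u : X -> R) :
  (forall x, \sum_y trans_prob a x y * u y = u x) -> forall x y, u x = u y.
Proof.
move=> harm_u.
have /card_gt0P[z _] : (0 < #|X|)%N by apply: ltnW.
have [m _ max_m] := @arg_maxP _ _ _ z predT u isT.
have step x y : u x = u m -> E x y -> u y = u m.
  move=> ux Exy.
  have term_ge0 t : true -> 0 <= trans_prob a x t * (u m - u t).
    by move=> _; rewrite mulr_ge0 ?trans_prob_ge0 // subr_ge0; apply: max_m.
  have sum0 : \sum_t trans_prob a x t * (u m - u t) = 0.
    under eq_bigr do rewrite mulrBr.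
    by rewrite sumrB -mulr_suml sum_trans_prob mul1r harm_u ux subrr.
  have /eqP := @psumr_eq0P _ _ _ _ term_ge0 sum0 y isT.
  by rewrite mulf_eq0 gt_eqF ?trans_prob_gt0 //= subr_eq0 => /eqP.
suff all_m x : u x = u m by move=> x y; rewrite !all_m.
have /connectP[p path_p ->] := E_connected m x.
have: u m = u m by [].
move: {1 2 4}m path_p => v; elim: p v => //= t p IHp v /andP[Evt path_p] uv.
by apply: IHp path_p _; apply: step Evt.
Qed.

Lemma sum_enum_val (S : nmodType) (F : X -> S) :
  \sum_(i < #|X|) F (enum_val i) = \sum_x F x.
Proof. by rewrite -(big_enum_val F); apply: eq_bigl. Qed.

(** The transpose of the Laplacian: functions on [X] are encoded as row vectors
    multiplied on the left, so that the image of the Laplacian is the row space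
    and its kernel is [kermx]. *)
Definition laplacian_mx : 'M[R]_#|X| :=
  \matrix_(i, j) (trans_prob a (enum_val j) (enum_val i) - (i == j)%:R).

(** Stated over an arbitrary extension [S] of the scalars, so as to serve both
    real harmonic functions and complex solutions. *)
Lemma mul_laplacian_mx (S : fieldType) (phi : {rmorphism R -> S})
    (u : X -> S) j :
  ((\row_i u (enum_val i)) *m map_mx phi laplacian_mx) 0 j =
  \sum_y phi (trans_prob a (enum_val j) y) * u y - u (enum_val j).
Proof.
rewrite mxE; under eq_bigr do rewrite !mxE rmorphB rmorph_nat mulrBr.
rewrite sumrB; congr (_ - _).
  rewrite -[RHS]sum_enum_val; by apply: eq_bigr => i _; rewrite mulrC.
rewrite (bigD1 j) //= eqxx mulr1 big1 ?addr0 // => i /negPf ->.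
by rewrite mulr0.
Qed.

(** Rank-nullity: the kernel consists of harmonic functions, hence lies on the
    line of constants. *)
Lemma rank_laplacian_mx : (#|X|.-1 <= \rank laplacian_mx)%N.
Proof.
suff: (\rank (kermx laplacian_mx) <= 1)%N.
  by rewrite mxrank_ker -subn1 !leq_subLR addnC.
suff sub : (kermx laplacian_mx <= (const_mx 1 : 'rV_#|X|))%MS.
  exact: leq_trans (mxrankS sub) (rank_leq_row _).
apply/rV_subP => v /sub_kermxP vL0.
have v_row : v = \row_i v 0 (enum_rank (enum_val i)).
  by apply/rowP => i; rewrite mxE enum_valK.
have const_v : forall x y, v 0 (enum_rank x) = v 0 (enum_rank y).
  apply: (@harmonic_constant (fun x => v 0 (enum_rank x))) => x; apply/eqP; rewrite -subr_eq0.
  have := mul_laplacian_mx (idfun : {rmorphism R -> R}) (fun x => v 0 (enum_rank x)) (enum_rank x).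
  by rewrite map_mx_id // -v_row vL0 mxE enum_rankK /= => <-.
have /card_gt0P[z _] : (0 < #|X|)%N by apply: ltnW.
apply/sub_rVP; exists (v 0 (enum_rank z)); apply/rowP => i.
by rewrite !mxE mulr1 -(const_v (enum_val i)) enum_valK.
Qed.

Variable pi : X -> R.
Hypothesis pi_stationary : stationary_distribution a pi.

Definition pi_col : 'cV[R]_#|X| := \col_i pi (enum_val i).

Lemma laplacian_mx_stationary : laplacian_mx *m pi_col = 0.
Proof.
have [inv_pi _ _] := pi_stationary.
apply/colP => i; rewrite !mxE; under eq_bigr do rewrite !mxE mulrBl.
rewrite sumrB; apply/eqP; rewrite subr_eq0; apply/eqP.
rewrite [RHS](bigD1 i) //= eqxx mul1r [X in _ + X]big1 ?addr0; last first.
  by move=> j; rewrite eq_sym => /negPf neq_ij; rewrite neq_ij mul0r.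
rewrite -[RHS]inv_pi -[RHS]sum_enum_val.
by apply: eq_bigr => j _; rewrite mulrC.
Qed.

(** Inclusion of the image in the hyperplane orthogonal to [pi] is stationarity;
    equality follows by comparing ranks, as [pi] is nonzero. *)
Lemma laplacian_mx_image : (laplacian_mx :=: kermx pi_col)%MS.
Proof.
have sub : (laplacian_mx <= kermx pi_col)%MS.
  by apply/sub_kermxP; apply: laplacian_mx_stationary.
apply/eqmxP; rewrite -(geq_leqif (mxrank_leqif_eq sub)).
apply: leq_trans rank_laplacian_mx; rewrite mxrank_ker -subn1 leq_sub2l //.
rewrite lt0n mxrank_eq0; apply/eqP => pi0.
have /card_gt0P[z _] : (0 < #|X|)%N by apply: ltnW.
have [_ pi_gt0 _] := pi_stationary; have := pi_gt0 z.
have /colP/(_ (enum_rank z)) := pi0; rewrite !mxE enum_rankK => ->.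
by rewrite ltxx.
Qed.

(** Solvability is membership in the complex row space, which by extension of
    scalars is again the hyperplane orthogonal to [pi]. *)
Lemma poisson_solvable (h : X -> R[i]) :
  (exists u, poisson_solution a h u) <-> \sum_x h x * (pi x)%:C%C = 0.
Proof.
pose phi := real_complex R : {rmorphism R -> R[i]}.
pose hrow : 'rV_#|X| := \row_i h (enum_val i).
have solP : (exists u, poisson_solution a h u) <->
    (hrow <= map_mx phi laplacian_mx)%MS.
  split=> [[u sol_u]|/submxP[v hv]].
    apply/submxP; exists (\row_i u (enum_val i)); apply/rowP => j.
    by rewrite mul_laplacian_mx mxE -sol_u.
  exists (fun x => v 0 (enum_rank x)) => x.
  have := mul_laplacian_mx phi (fun x => v 0 (enum_rank x)) (enum_rank x).
  have -> : \row_i v 0 (enum_rank (enum_val i)) = v.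
    by apply/rowP => i; rewrite mxE enum_valK.
  by rewrite -hv mxE enum_rankK => ->.
have kerP : (hrow *m map_mx phi pi_col) 0 0 = \sum_x h x * (pi x)%:C%C.
  rewrite mxE -[RHS]sum_enum_val.
  by apply: eq_bigr => i _; rewrite !mxE.
have imageE : (map_mx phi laplacian_mx :=: kermx (map_mx phi pi_col))%MS.
  by apply/eqmxP; rewrite -map_kermx !map_submx; apply/eqmxP; apply: laplacian_mx_image.
rewrite solP imageE -kerP; split=> [/sub_kermxP -> | hpi]; first by rewrite mxE.
by apply/sub_kermxP/matrixP => i j; rewrite !ord1 hpi mxE.
Qed.

End Chain.

Section Gluing.
Set Implicit Arguments.
Unset Strict Implicit.
Variables (R : realType) (X : finType) (bd : {set X}).
Variables (f : funs_on R (interior bd)) (g : funs_on R bd).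

Lemma glue_data_interior (x : {x : X | x \in interior bd}) :
  glue_data f g (val x) = f x.
Proof.
rewrite /glue_data; move: (boolP (val x \in bd)).
(* The branches use the membership proofs, so only the index of the view, its
   third occurrence, can be generalized. *)
move: {3}(val x \in bd) => _ [x_bd|x_nbd]; last by congr f; apply: val_inj.
by have := valP x; rewrite inE x_bd.
Qed.

Lemma glue_data_bd (y : {y : X | y \in bd}) : glue_data f g (val y) = - g y.
Proof.
rewrite /glue_data; move: (boolP (val y \in bd)).
(* As above, only the index of the view is generalized. *)
move: {3}(val y \in bd) => _ [y_bd|y_nbd]; first by congr (- g _); apply: val_inj.
by have := y_nbd; rewrite (valP y).
Qed.

Lemma integral_glue_data (pi : X -> R) :
  \sum_x glue_data f g x * (pi x)%:C%C = integral_on pi f - integral_on pi g.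
Proof.
rewrite (bigID (mem bd)) /= addrC; congr (_ + _).
  under eq_bigl do rewrite -in_setC.
  rewrite big_sub; apply: eq_bigr => x _; by rewrite glue_data_interior.
rewrite big_sub /integral_on -sumrN.
by apply: eq_bigr => y _; rewrite glue_data_bd mulNr.
Qed.

Lemma neumann_poisson (a : X -> X -> R) (u : X -> R[i]) :
  neumann_solution a f g u <-> poisson_solution a (glue_data f g) u.
Proof.
split=> [[sol_f sol_g] x|sol].
  case: (boolP (x \in bd)) => [x_bd|/notin_bd_interior x_in].
    have := glue_data_bd (exist _ x x_bd); rewrite -sol_g => -> /=.
    by rewrite opprK.
  by have := glue_data_interior (exist _ x x_in); rewrite -sol_f.
split=> [x|y]; first by rewrite sol glue_data_interior.
by rewrite /normal_derivative sol glue_data_bd opprK.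
Qed.

End Gluing.

Theorem mainTheorem2 (R : realType) (X : finType) (E : rel X)
    (a : X -> X -> R) (pi : X -> R) (bd : {set X})
    (card_X : (2 <= #|X|)%N)
    (E_loopless : loopless E)
    (E_connected : strongly_connected E)
    (a_weights : edge_weights E a)
    (pi_stationary : stationary_distribution a pi)
    (bd_nonempty : bd != set0)
    (f : funs_on R (interior bd)) (g : funs_on R bd) :
  (forall u : X -> R[i],
     neumann_solution a f g u <-> poisson_solution a (glue_data f g) u) /\
  ((exists u : X -> R[i], neumann_solution a f g u) <->
     integral_on pi f = integral_on pi g).
Proof.
have neumannP := neumann_poisson f g a; split; first exact: neumannP.
have [sol0 sol1] := poisson_solvable card_X E_connected a_weights pi_stationary
  (glue_data f g).
rewrite integral_glue_data in sol0 sol1; split=> [[u /neumannP sol_u]|fg].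
  by apply/eqP; rewrite -subr_eq0; apply/eqP/sol0; exists u.
by have [|u /neumannP sol_u] := sol1; [rewrite fg subrr | exists u].
Qed.
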